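(* Let $m\ge 0$ be an integer and let $\mathcal{H}$ be a Hilbert space. Let $T\in \mathcal{B}(\mathcal{H})$ satisfy $$\sup_{n\ge 1} n^{-m/2}\|T^n\|<\infty.$$ Then $T$ has an $(m+3)$-isometric lifting. Moreover, the $(m+3)$-isometric lifting can be chosen to be expansive and analytic.
   Context: $\mathcal{B}(\mathcal{K})$ denotes the bounded linear operators on a Hilbert space $\mathcal{K}$. If $\mathcal{H}$ is a closed subspace of a Hilbert space $\mathcal{K}$ and $P_{\mathcal{H}}$ is the orthogonal projection onto $\mathcal{H}$, an operator $S\in\mathcal{B}(\mathcal{K})$ is a lifting of $T\in\mathcal{B}(\mathcal{H})$ if $TP_{\mathcal{H}}=P_{\mathcal{H}}S$ (equivalently, $S^*\mathcal{H}\subset\mathcal{H}$ and $S^*|_{\mathcal{H}}=T^*$); liftings are understood up to unitary equivalence, i.e. $T$ has a lifting with property P if there is a Hilbert space $\mathcal{K}$ containing (an isometric copy of) $\mathcal{H}$ and such an $S$. An operator $S$ is $m$-isometric ($m\ge1$) if $\sum_{j=0}^m (-1)^j\binom{m}{j} S^{*j}S^j=0$. $S\in\mathcal{B}(\mathcal{K})$ is expansive if $\|Sx\|\ge\|x\|$ for all $x\in\mathcal{K}$, and analytic if $\bigcap_{n\ge0}S^n(\mathcal{K})=\{0\}$. *)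

(* Defs.v *)
(* complex Hilbert spaces over C := R[i], R : realType. *)
From mathcomp Require Import all_boot all_order all_algebra.
From mathcomp Require Import complex.
From mathcomp Require Import boolp classical_sets reals.
Import GRing.Theory Num.Theory.
Local Open Scope ring_scope.
Local Open Scope complex_scope.
Local Open Scope classical_set_scope.

Set Implicit Arguments.
Unset Strict Implicit.
Unset Printing Implicit Defensive.

Section Hilbert.
Variable R : realType.
Notation C := (R[i]).

(* ip is a (complex) inner product on V: linear in the first argument,
   conjugate symmetric, positive definite. *)
Definition is_inner_product (V : lmodType C) (ip : V -> V -> C) : Prop :=
  [/\ (forall (a : C) (x y z : V), ip (a *: x + y) z = a * ip x z + ip y z),
      (forall x y : V, ip y x = (ip x y)^*),
      (forall x : V, 0 <= ip x x) &
      (forall x : V, ip x x = 0 -> x = 0)].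

(* The norm induced by the inner product. *)
Definition hnorm (V : lmodType C) (ip : V -> V -> C) (x : V) : R :=
  Num.sqrt (complex.Re (ip x x)).

(* Completeness with respect to the induced norm. *)
Definition ip_complete (V : lmodType C) (ip : V -> V -> C) : Prop :=
  forall u : nat -> V,
    (forall e : R, 0 < e -> exists N : nat, forall n k : nat,
        (N <= n)%N -> (N <= k)%N -> hnorm ip (u n - u k) < e) ->
    exists l : V, forall e : R, 0 < e -> exists N : nat, forall n : nat,
        (N <= n)%N -> hnorm ip (u n - l) < e.

(* (V, ip) is a complex Hilbert space. *)
Definition is_hilbert (V : lmodType C) (ip : V -> V -> C) : Prop :=
  is_inner_product ip /\ ip_complete ip.

Definition is_linear_map (U V : lmodType C) (f : U -> V) : Prop :=
  forall (a : C) (x y : U), f (a *: x + y) = a *: f x + f y.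

(* T is in B(V): a bounded linear operator. *)
Definition bounded_op (V : lmodType C) (ip : V -> V -> C) (T : V -> V) : Prop :=
  is_linear_map T /\ exists M : R, forall x : V, hnorm ip (T x) <= M * hnorm ip x.

(* Operator norm ||T|| = sup { ||T x|| : ||x|| <= 1 }. *)
Definition opnorm (V : lmodType C) (ip : V -> V -> C) (T : V -> V) : R :=
  sup [set hnorm ip (T x) | x in [set x : V | hnorm ip x <= 1]].

(* Ta is the adjoint of T. *)
Definition is_adjoint (V : lmodType C) (ip : V -> V -> C) (T Ta : V -> V) : Prop :=
  forall x y : V, ip (T x) y = ip x (Ta y).

(* S is m-isometric: sum_{j=0}^m (-1)^j C(m,j) S^{*j} S^j = 0. *)
Definition m_isometric (V : lmodType C) (ip : V -> V -> C) (m : nat) (S : V -> V) : Prop :=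
  exists Sa : V -> V, is_adjoint ip S Sa /\
    forall x : V,
      \sum_(j < m.+1) (((-1) ^+ j * ('C(m, j))%:R) *: iter j Sa (iter j S x)) = 0.

Definition expansive (V : lmodType C) (ip : V -> V -> C) (S : V -> V) : Prop :=
  forall x : V, hnorm ip x <= hnorm ip (S x).

(* bigcap_n S^n(V) = {0} *)
Definition analytic (V : lmodType C) (S : V -> V) : Prop :=
  forall x : V, (forall n : nat, exists y : V, x = iter n S y) -> x = 0.

(* J : H -> K is a linear isometric embedding (identifying H with J(H)). *)
Definition isometric_embedding (H K : lmodType C) (ipH : H -> H -> C)
  (ipK : K -> K -> C) (J : H -> K) : Prop :=
  is_linear_map J /\ forall x y : H, ipK (J x) (J y) = ipH x y.

(* S in B(K) is a lifting of T in B(H) (H embedded in K via J):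
   S^* J(H) ⊂ J(H) and S^*|_H = T^*, i.e. S^* (J h) = J (T^* h). *)
Definition is_lifting (H K : lmodType C) (ipH : H -> H -> C)
  (ipK : K -> K -> C) (J : H -> K) (T : H -> H) (S : K -> K) : Prop :=
  exists (Ta : H -> H) (Sa : K -> K),
    [/\ is_adjoint ipH T Ta, is_adjoint ipK S Sa &
        forall h : H, Sa (J h) = J (Ta h)].

End Hilbert.

(* Main.v *)
(* Put w_n = 1 + L n^(m+2). The forward shift S on the weighted space of
   sequences x with norm^2 = sum_n w_n ||x_n||_b^2 is expansive and analytic, and
   it is (m+3)-isometric because ||S^j x||^2 is a polynomial of degree m+2 in j.
   Its adjoint is the weighted backward shift, so h |-> (w_n^-1 T^{*n} h)_n
   intertwines T^* and S^*. This map is isometric exactly when the form b on H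
   satisfies sum_n k_n b(T^{*n} x, T^{*n} y) = <x, y> with k_n = 1/w_n, which is
   solved by b(x, y) = sum_n g_n <T^{*n} x, T^{*n} y>, where sum g_n z^n is the
   reciprocal of sum k_n z^n. The growth of T gives
   ||T^{*n} x||^2 <= C (n+1)^m ||x||^2; since (n+1)^m is submultiplicative, and
   sum_{n >= 1} k_n (n+1)^m is as small as we like for L large, g is
   summable against (n+1)^m and b is a small perturbation of <x, y>, hence an
   equivalent inner product. *)
From HB Require Import structures.
Require Import Defs.
From mathcomp Require Import all_boot all_order all_algebra.
From mathcomp Require Import complex.
From mathcomp Require Import boolp classical_sets functions reals topology.
From mathcomp Require Import normedtype sequences.
From mathcomp Require Import zify ring lra.
Import Order.TTheory GRing.Theory Num.Theory numFieldNormedType.Exports.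
Local Open Scope ring_scope.
Local Open Scope complex_scope.
Local Open Scope classical_set_scope.

Set Implicit Arguments.
Unset Strict Implicit.
Unset Printing Implicit Defensive.

(** * Absolutely convergent real series *)

Section AbsolutelySummable.
Variable R : realType.
Implicit Types u v : R^nat.

Definition abs_summable u := cvgn (series (fun n => `|u n|)).
Definition rsum u : R := limn (series u).

Lemma abs_summable_cvg u : abs_summable u -> cvgn (series u).
Proof. exact: normed_cvg. Qed.

Lemma nonneg_series_bounded_cvg u (M : R) : (forall n, 0 <= u n) ->
  (forall n, series u n <= M) -> cvgn (series u).
Proof.
move=> u0 uM; apply: nondecreasing_is_cvgn.
  by apply: nondecreasing_series => n _ _; exact: u0.
by exists M => _ [n _ <-].
Qed.

Lemma abs_summable_bounded u (M : R) :
  (forall n, \sum_(i < n) `|u i| <= M) -> abs_summable u.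
Proof.
move=> uM; apply: (@nonneg_series_bounded_cvg _ M) => // n.
by rewrite seriesEord; exact: uM.
Qed.

Lemma abs_summable_le u v : (forall n, `|u n| <= v n) -> cvgn (series v) ->
  abs_summable u.
Proof.
by move=> uv cv; apply: series_le_cvg cv => // n; exact: le_trans (uv n).
Qed.

Lemma cvg_seriesM (a : R) u :
  cvgn (series u) -> cvgn (series (fun n => a * u n)).
Proof. exact: is_cvg_seriesZ. Qed.

Lemma rsumD u v : abs_summable u -> abs_summable v ->
  rsum (fun n => u n + v n) = rsum u + rsum v.
Proof.
by move=> su sv; apply: lim_seriesD; exact: abs_summable_cvg.
Qed.

Lemma rsumZ (a : R) u : abs_summable u -> rsum (fun n => a * u n) = a * rsum u.
Proof.
by move=> su; apply: lim_seriesZ; exact: abs_summable_cvg.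
Qed.

Lemma series_le_rsum u n : (forall n, 0 <= u n) -> cvgn (series u) ->
  \sum_(i < n) u i <= rsum u.
Proof.
move=> u0 cu; have := @nondecreasing_cvgn_le R (series u).
rewrite /rsum [X in _ -> _ -> forall n, X n <= _]seriesEord; apply => //.
by apply: nondecreasing_series => k _ _; exact: u0.
Qed.

Lemma rsum_le u (M : R) : cvgn (series u) -> (forall n, \sum_(i < n) u i <= M) ->
  rsum u <= M.
Proof.
move=> cu uM; apply: limr_le => //.
by apply: nearW => n /=; rewrite seriesEord; exact: uM.
Qed.

Lemma ler_rsum u v : cvgn (series u) -> cvgn (series v) ->
  (forall n, u n <= v n) -> rsum u <= rsum v.
Proof. by move=> cu cv uv; apply: lim_series_le. Qed.

Lemma rsum_ge0 u : (forall n, 0 <= u n) -> cvgn (series u) -> 0 <= rsum u.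
Proof. by move=> u0 /(series_le_rsum 0 u0); rewrite big_ord0. Qed.

Lemma normr_rsum u : abs_summable u -> `|rsum u| <= rsum (fun n => `|u n|).
Proof. move=> su; exact: (@lim_series_norm _ R u). Qed.

Lemma cvg_seriesS u (l : R) :
  series (fun n => u n.+1) @ \oo --> l -> series u @ \oo --> u 0%N + l.
Proof.
move=> cu; rewrite -(cvg_shiftS (series u)).
rewrite (_ : [sequence _]_n = (fun n => u 0%N + series (fun k => u k.+1) n)).
  by apply: cvgD => //; exact: cvg_cst.
by apply/funext => n; rewrite /= !seriesEord /= big_ord_recl.
Qed.

Lemma rsumS u : abs_summable (fun n => u n.+1) ->
  rsum u = u 0%N + rsum (fun n => u n.+1).
Proof.
by move=> su; apply/cvg_lim => //; apply: cvg_seriesS; exact: abs_summable_cvg.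
Qed.

Lemma abs_summable_shift u k : abs_summable u -> abs_summable (fun n => u (n + k)%N).
Proof.
move=> su; apply: (@abs_summable_bounded _ (rsum (fun n => `|u n|))) => n.
apply: le_trans (series_le_rsum (n + k) _ su) => //.
rewrite addnC big_split_ord /= -[leLHS]add0r lerD ?sumr_ge0 //.
by apply: ler_sum => i _; rewrite addnC.
Qed.

Lemma abs_summableS u : abs_summable u -> abs_summable (fun n => u n.+1).
Proof.
move=> su; have := abs_summable_shift (k := 1) su; congr abs_summable.
by apply/funext => n; rewrite addn1.
Qed.

End AbsolutelySummable.

(** * Inverting a summable convolution on sequences of controlled growth *)

Section Convolution.
Variable R : realType.

(** The triangle [i + j < N] is summed by rows and by antidiagonals [p = i + j]; passing from [N] to
    [N.+1] adds one antidiagonal. *)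
Lemma antidiagonal_sum (V : nmodType) (f : nat -> nat -> V) N :
  \sum_(i < N) \sum_(j < N - i) f i j = \sum_(p < N) \sum_(i < p.+1) f i (p - i)%N.
Proof.
elim: N => [|N IH]; first by rewrite !big_ord0.
rewrite [RHS]big_ord_recr -IH [LHS]big_ord_recr /= subSnn big_ord1.
rewrite (big_ord_recr N (fun i => f i (N - i)%N)) /= subnn addrA -big_split /=.
congr (_ + _).
by apply: eq_bigr => i _; rewrite subSn ?big_ord_recr // ltnW.
Qed.

Lemma rsum_tail (u : R^nat) p : abs_summable u ->
  rsum u = \sum_(i < p) u i + rsum (fun n => u (n + p)%N).
Proof.
elim: p u => [|p IH] u su.
  by rewrite big_ord0 add0r; congr rsum; apply/funext => n; rewrite addn0.
rewrite rsumS; last exact: abs_summableS.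
rewrite (IH (fun n => u n.+1)); last exact: abs_summableS.
rewrite big_ord_recl addrA; congr (_ + _); congr rsum.
by apply/funext => n; rewrite addnS.
Qed.

Variables (k g nu a : R^nat) (C : R).
Hypothesis nu_ge0 : forall n, 0 <= nu n.
Hypothesis nu_subM : forall i j, nu (i + j)%N <= nu i * nu j.
Hypothesis sk : abs_summable (fun n => k n * nu n).
Hypothesis sg : abs_summable (fun n => g n * nu n).
Hypothesis kg : forall p, \sum_(i < p.+1) k i * g (p - i)%N = (p == 0)%:R.
Hypothesis C_ge0 : 0 <= C.
Hypothesis aC : forall n, `|a n| <= C * nu n.

Let kap : R^nat := fun n => `|k n * nu n|.
Let gam : R^nat := fun n => `|g n * nu n|.
Let A n := rsum (fun j => g j * a (n + j)%N).

(** Submultiplicativity of [nu] separates the two indices, so the majorant factors into [nu n] and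
    the summable [gam j]. *)
Let term_le n j : `|g j * a (n + j)%N| <= C * nu n * gam j.
Proof.
rewrite normrM /gam normrM (ger0_norm (nu_ge0 j)).
have -> : C * nu n * (`|g j| * nu j) = `|g j| * (C * (nu n * nu j)) by ring.
by rewrite ler_wpM2l // (le_trans (aC _)) // ler_wpM2l.
Qed.

Let sga n : abs_summable (fun j => g j * a (n + j)%N).
Proof. by apply: (abs_summable_le (term_le n)); exact: cvg_seriesM sg. Qed.

(** With [p = 0] this bounds [A n] by a multiple of [nu n], hence the outer series converges;
    general [p] measures the cost of truncating the inner series. *)
Let norm_tail n p :
  `|A n - \sum_(j < p) g j * a (n + j)%N|
    <= C * nu n * (rsum gam - \sum_(j < p) gam j).
Proof.
have sgam : abs_summable gam.
  by apply: abs_summable_le (sg) => j; rewrite normr_id.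
rewrite /A (rsum_tail p (@sga n)) addrC addKr (rsum_tail p sgam) addrAC subrr add0r.
apply: le_trans (normr_rsum _) _; first exact: abs_summable_shift (@sga n).
have sgamp := abs_summable_shift (k := p) sgam.
rewrite -rsumZ //; apply: ler_rsum => //.
- exact: (abs_summable_shift (k := p) (@sga n)).
- by apply: cvg_seriesM; exact: (abs_summable_cvg sgamp).
Qed.

Let sA : abs_summable (fun n => k n * A n).
Proof.
apply: (@abs_summable_le _ _ (fun n => C * rsum gam * kap n)) => [n|]; last first.
  exact: cvg_seriesM sk.
have := norm_tail n 0; rewrite !big_ord0 !subr0 => An.
rewrite normrM /kap normrM (ger0_norm (nu_ge0 n)).
have -> : C * rsum gam * (`|k n| * nu n) = `|k n| * (C * nu n * rsum gam) by ring.
by rewrite ler_wpM2l.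
Qed.

(** When [M + M <= N], the square of side [M] lies inside the triangle [n + j < N]. What the
    triangle leaves out is thus dominated by the part of the product of the majorants outside the
    square. *)
Let partial_bound M N : (0 < M)%N -> (M + M <= N)%N ->
  `|\sum_(n < N) k n * A n - a 0%N|
    <= C * (rsum kap * rsum gam - (\sum_(n < M) kap n) * (\sum_(n < M) gam n)).
Proof.
move=> M0 MN; have N0 : (0 < N)%N by lia.
have gam0 n : 0 <= gam n by exact: normr_ge0.
have kap0 n : 0 <= kap n by exact: normr_ge0.
(* Grouped by [p = n + j], the triangular sum is [a p] times the convolution coefficient of index
   [p], and only [p = 0] survives. *)
have -> : a 0%N = \sum_(n < N) k n * \sum_(j < N - n) g j * a (n + j)%N.
  under eq_bigr do rewrite mulr_sumr.
  rewrite (antidiagonal_sum (fun n j => k n * (g j * a (n + j)%N))).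
  rewrite -(prednK N0) big_ord_recl [X in _ + X]big1 ?addr0 => [|p _].
    by rewrite /= big_ord1 /= mulrA; have := kg 0; rewrite big_ord1 => ->;
       rewrite mul1r.
  transitivity ((\sum_(i < p.+2) k i * g (p.+1 - i)%N) * a p.+1).
    rewrite mulr_suml; apply: eq_bigr => i _; rewrite mulrA.
    by rewrite subnKC // -ltnS.
  by rewrite kg mul0r.
rewrite -sumrB; apply: le_trans (ler_norm_sum _ _ _) _.
pose F n := C * kap n * (rsum gam - \sum_(j < N - n) gam j).
apply: (@le_trans _ _ (\sum_(n < N) F n)).
  apply: ler_sum => n _; rewrite -mulrBr normrM /F /kap normrM.
  rewrite (ger0_norm (nu_ge0 n)) [C * _]mulrCA -mulrA ler_wpM2l //.
have -> : \sum_(n < N) F n = C * ((\sum_(n < N) kap n) * rsum gam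
    - \sum_(n < N) kap n * \sum_(j < N - n) gam j).
  rewrite mulr_suml -sumrB mulr_sumr; apply: eq_bigr => n _.
  by rewrite /F -mulrA mulrBr.
rewrite ler_wpM2l // lerB //.
  rewrite ler_wpM2r //; last exact: series_le_rsum.
  by apply: rsum_ge0 => //; exact: sg.
rewrite mulr_suml -(subnKC (leq_trans (leq_addr M M) MN)) big_split_ord /=.
rewrite -[leLHS]addr0 lerD //; last first.
  by apply: sumr_ge0 => n _; rewrite mulr_ge0 ?sumr_ge0.
apply: ler_sum => n _; rewrite ler_wpM2l //.
have nM := ltn_ord n.
rewrite (_ : (M + (N - M) - n = M + (N - M - n))%N); last by lia.
by rewrite big_split_ord /= lerDl sumr_ge0.
Qed.

(* The partial sums of the double series are compared with its triangular
   partial sums, which telescope to a_0 because k * g = 1; the difference is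
   controlled by a Cauchy product of nonnegative series. *)
Lemma rsum_convolution_inverse :
  rsum (fun n => k n * rsum (fun j => g j * a (n + j)%N)) = a 0%N.
Proof.
rewrite -/(A _); set S := rsum _.
have cS : series (fun n => k n * A n) @ \oo --> S by exact: abs_summable_cvg sA.
pose E M := C * (rsum kap * rsum gam - (\sum_(n < M) kap n) * (\sum_(n < M) gam n)).
(* The bound [E M] does not depend on [N], so [N] goes to infinity first and [M] afterwards. *)
have SE M : (0 < M)%N -> `|S - a 0%N| <= E M.
  move=> M0; have cN : (fun N => `|series (fun n => k n * A n) N - a 0%N|) @ \oo
      --> `|S - a 0%N|.
    by apply: cvg_norm; apply: cvgB => //; exact: cvg_cst.
  rewrite -(cvg_lim _ cN) //; apply: limr_le; first by apply/cvg_ex; eexists; exact: cN.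
  by near=> N; rewrite seriesEord; apply: partial_bound => //; near: N;
     exact: nbhs_infty_ge.
have cE : E @ \oo --> C * (rsum kap * rsum gam - rsum kap * rsum gam).
  apply: cvgM; first exact: cvg_cst.
  apply: cvgB; first exact: cvg_cst.
  by apply: cvgM; rewrite /rsum seriesEord; [have := sk|have := sg];
     rewrite /abs_summable seriesEord.
rewrite subrr mulr0 in cE.
suff : `|S - a 0%N| <= 0 by rewrite normr_le0 subr_eq0 => /eqP.
rewrite -(cvg_lim _ cE) //; apply: limr_ge; first by apply/cvg_ex; eexists; exact: cE.
by near=> M; apply: SE; near: M; exact: nbhs_infty_ge.
Unshelve. all: by end_near.
Qed.

End Convolution.

(** * Real parts of inner products *)

Section LinearMaps.
Variables (R : realType) (U V : lmodType R[i]).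

Section Basic.
Variable f : U -> V.
Hypothesis lf : is_linear_map f.

Lemma linear_map0 : f 0 = 0.
Proof.
by have := lf 1 0 0; rewrite !scale1r addr0 -[X in X = _]addr0 => /addrI.
Qed.

Lemma linear_mapD x y : f (x + y) = f x + f y.
Proof. by have := lf 1 x y; rewrite !scale1r. Qed.

Lemma linear_mapZ (a : R[i]) x : f (a *: x) = a *: f x.
Proof. by have := lf a x 0; rewrite linear_map0 !addr0. Qed.
End Basic.

Lemma iter_linear_map n (f : U -> U) : is_linear_map f -> is_linear_map (iter n f).
Proof. by move=> lf; elim: n => // n IH a x y /=; rewrite IH lf. Qed.

End LinearMaps.

Section RealForms.
Variables (R : realType) (V : lmodType R[i]).
Implicit Types (r : V -> V -> R) (x y z : V).

(* The axioms of the real part of an inner product: it determines the inner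
   product as r x y + i r x (i y), and every limit below is taken in R. *)
Record hermitian_real_part r : Prop := HermitianRealPart {
  hrpD : forall x y z, r (x + y) z = r x z + r y z;
  hrpZ : forall (a : R) x z, r (a%:C *: x) z = a * r x z;
  hrpC : forall x y, r y x = r x y;
  hrpi : forall x y, r ('i *: x) ('i *: y) = r x y;
  hrp_ge0 : forall x, 0 <= r x x;
  hrp_eq0 : forall x, r x x = 0 -> x = 0 }.

Definition form_complete r := forall u : nat -> V,
  (forall e : R, 0 < e -> exists N, forall n k, (N <= n)%N -> (N <= k)%N ->
    r (u n - u k) (u n - u k) < e) ->
  exists l, forall e : R, 0 < e -> exists N, forall n, (N <= n)%N ->
    r (u n - l) (u n - l) < e.

(** Equivalent norms have the same Cauchy and convergent sequences; this will carry completeness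
    over to the renormed space. *)
Lemma form_complete_equiv (r b : V -> V -> R) (c d : R) :
  0 < c -> (forall x, c * r x x <= b x x) ->
  0 < d -> (forall x, b x x <= d * r x x) -> form_complete r -> form_complete b.
Proof.
move=> c0 cb d0 bd cr u uC; have [|l ul] := @cr u.
  move=> e e0; have [|N uN] := uC (c * e); first exact: mulr_gt0.
  exists N => n k nN kN; have := uN n k nN kN.
  by move=> /(le_lt_trans (cb _)); rewrite ltr_pM2l.
exists l => e e0; have [|N uN] := ul (e / d); first exact: divr_gt0.
exists N => n nN; apply: le_lt_trans (bd _) _.
by have := uN n nN; rewrite ltr_pdivlMr // mulrC.
Qed.

(** Conjugate linearity in the second argument gives <x, i y> = - i <x, y>, whose real part is the
    imaginary part of <x, y>. *)
Definition ip_of_form r x y : R[i] := r x y +i* r x ('i *: y).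

Definition form_of_ip (ip : V -> V -> R[i]) x y : R := complex.Re (ip x y).

Lemma scale_complexE (a : R[i]) x :
  a *: x = (complex.Re a)%:C *: x + 'i *: ((complex.Im a)%:C *: x).
Proof. by rewrite scalerA -scalerDl -complexE. Qed.

Section Theory.
Variable r : V -> V -> R.
Hypothesis hr : hermitian_real_part r.

Lemma hrpDr x y z : r x (y + z) = r x y + r x z.
Proof. by rewrite hrpC // hrpD // !(hrpC hr _ x). Qed.

Lemma hrpZr (a : R) x z : r x (a%:C *: z) = a * r x z.
Proof. by rewrite hrpC // hrpZ // !(hrpC hr _ x). Qed.

Lemma hrp_ir x y : r x ('i *: y) = - r ('i *: x) y.
Proof.
rewrite -(hrpi hr x) scalerA -expr2 sqr_i -[-1]/(- (1%:C)) -rmorphN /= hrpZr.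
by rewrite mulN1r.
Qed.

Lemma hrpN x y : r (- x) y = - r x y.
Proof. by rewrite -scaleN1r -[-1]/(- (1%:C)) -rmorphN /= hrpZ // mulN1r. Qed.

Lemma hrpNr x y : r x (- y) = - r x y.
Proof. by rewrite hrpC // hrpN (hrpC hr). Qed.

Lemma hrp0l y : r 0 y = 0.
Proof. by rewrite -(scale0r 0) -[0%R]/(0%:C) hrpZ // mul0r. Qed.

Lemma hrp_scale_complex (a : R[i]) x : r (a *: x) (a *: x) =
  (complex.Re a ^+ 2 + complex.Im a ^+ 2) * r x x.
Proof.
(* Invariance under multiplication by ['i] makes this number its own opposite. *)
have ixx : r x ('i *: x) = 0.
  by have := hrp_ir x x; rewrite (hrpC hr x); lra.
rewrite (scale_complexE a) hrpD // !hrpDr (hrpi hr).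
have -> : 'i *: ((complex.Im a)%:C *: x) = (complex.Im a)%:C *: ('i *: x).
  by rewrite !scalerA mulrC.
by rewrite !(hrpZ hr, hrpZr) (hrpC hr x) ixx; ring.
Qed.

Lemma hrp_sqD x y : r (x + y) (x + y) = r x x + 2 * r x y + r y y.
Proof. by rewrite hrpD // !hrpDr // (hrpC hr x y); ring. Qed.

Lemma hrp_sqB x y : r (x - y) (x - y) = r x x - 2 * r x y + r y y.
Proof. by rewrite hrp_sqD hrpNr hrpN hrpNr; ring. Qed.

Lemma hrp_sqD_le x y : r (x + y) (x + y) <= 2 * r x x + 2 * r y y.
Proof. by have := hrp_ge0 hr (x - y); rewrite hrp_sqB hrp_sqD; lra. Qed.

Lemma hrp_CauchySchwarz x y : r x y ^+ 2 <= r x x * r y y.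
Proof.
have [y0|y0] := eqVneq (r y y) 0.
  by rewrite (hrp_eq0 hr y0) (hrpC hr 0) !hrp0l expr0n mulr0.
have ygt0 : 0 < r y y by rewrite lt_def y0 hrp_ge0.
have := hrp_ge0 hr ((r y y)%:C *: x - (r x y)%:C *: y).
rewrite hrp_sqB !(hrpZ hr, hrpZr).
have -> : r y y * (r y y * r x x) - 2 * (r y y * (r x y * r x y))
   + r x y * (r x y * r y y) = r y y * (r x x * r y y - r x y ^+ 2) by ring.
by rewrite pmulr_rge0 // subr_ge0.
Qed.

Lemma hrp_norm_le x y : `|r x y| <= (r x x + r y y) / 2.
Proof.
have := hrp_ge0 hr (x - y); have := hrp_ge0 hr (x + y).
by rewrite hrp_sqB hrp_sqD => h1 h2; rewrite ler_norml; apply/andP; split; lra.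
Qed.

Lemma ip_of_form_inner_product : is_inner_product (ip_of_form r).
Proof.
have ixx x : r x ('i *: x) = 0.
  by have := hrp_ir x x; rewrite (hrpC hr x); lra.
split=> [[a b] x y z|x y|x|x].
- rewrite /ip_of_form !hrpD // scale_complexE /= !(hrpD hr) !(hrpZ hr).
  have -> t : r ('i *: (b%:C *: x)) t = - (b * r x ('i *: t)).
    by rewrite -(hrpZ hr) hrp_ir opprK.
  by rewrite (hrpi hr) (hrpZ hr); simpc.
- by rewrite /ip_of_form /= (hrpC hr x y) (hrpC hr ('i *: x)) hrp_ir opprK.
- by rewrite /ip_of_form ixx; simpc; exact: hrp_ge0.
- by rewrite /ip_of_form ixx => -[]; exact: hrp_eq0.
Qed.

Lemma hnorm_ip_of_form x : hnorm (ip_of_form r) x = Num.sqrt (r x x).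
Proof. by []. Qed.

Lemma sqrt_lt_sqr (a e : R) : 0 < e -> (Num.sqrt a < e) = (a < e ^+ 2).
Proof.
by move=> e0; rewrite -{1}(gtr0_norm e0) -sqrtr_sqr ltr_sqrt // exprn_gt0.
Qed.

Lemma ip_of_form_complete : form_complete r -> ip_complete (ip_of_form r).
Proof.
move=> cr u uC; have [|l ul] := cr u.
  move=> e e0; have [|N uN] := uC (Num.sqrt e); first by rewrite sqrtr_gt0.
  exists N => n k nN kN; have := uN n k nN kN.
  by rewrite hnorm_ip_of_form ltr_sqrt.
exists l => e e0; have [|N uN] := ul (e ^+ 2); first by rewrite exprn_gt0.
by exists N => n nN; rewrite hnorm_ip_of_form sqrt_lt_sqr // uN.
Qed.

Lemma ip_of_form_hilbert : form_complete r -> is_hilbert (ip_of_form r).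
Proof.
by move=> cr; split; [exact: ip_of_form_inner_product|exact: ip_of_form_complete].
Qed.

End Theory.

Section OfInnerProduct.
Variable ip : V -> V -> R[i].
Hypothesis hip : is_inner_product ip.

Let ipD x y z : ip (x + y) z = ip x z + ip y z.
Proof. by case: hip => ipl _ _ _; have := ipl 1 x y z; rewrite scale1r mul1r. Qed.

Let ip0 z : ip 0 z = 0.
Proof. by have := ipD 0 0 z; rewrite addr0 -[X in X = _]addr0 => /addrI. Qed.

Let ipZ a x z : ip (a *: x) z = a * ip x z.
Proof.
by case: hip => ipl _ _ _; have := ipl a x 0 z; rewrite addr0 ip0 addr0.
Qed.

Let ipC x y : ip y x = (ip x y)^*. Proof. by case: hip. Qed.

Lemma form_of_ip_hermitian : hermitian_real_part (form_of_ip ip).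
Proof.
rewrite /form_of_ip; split=> [x y z|a x z|x y|x y|x|x].
- by rewrite ipD; case: (ip x z) (ip y z) => ? ? [].
- by rewrite ipZ; case: (ip x z) => b c /=; ring.
- by rewrite ipC; case: (ip x y).
- by rewrite ipZ ipC ipZ ipC; case: (ip x y) => b c /=; ring.
- by case: hip => _ _ h _; have := h x; rewrite lecE => /andP[].
- case: hip => _ _ h h0 re0; apply: h0; move: re0; have := ger0_Im (h x).
  by case: (ip x x) => b c /= -> ->.
Qed.

Lemma form_of_ipK x y : ip_of_form (form_of_ip ip) x y = ip x y.
Proof.
rewrite /ip_of_form /form_of_ip [ip x ('i *: y)]ipC ipZ [ip y x]ipC.
by case: (ip x y) => b c /=; congr (_ +i* _); ring.
Qed.

Lemma form_of_ip_complete : ip_complete ip -> form_complete (form_of_ip ip).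
Proof.
move=> cip u uC; have [|l ul] := cip u.
  move=> e e0; have [|N uN] := uC (e ^+ 2); first by rewrite exprn_gt0.
  by exists N => n k nN kN; rewrite /hnorm sqrt_lt_sqr // uN.
exists l => e e0; have [|N uN] := ul (Num.sqrt e); first by rewrite sqrtr_gt0.
by exists N => n nN; have := uN n nN; rewrite /hnorm ltr_sqrt.
Qed.

End OfInnerProduct.

End RealForms.

(** * Riesz representation and adjoints *)

Section Riesz.
Variables (R : realType) (V : lmodType R[i]) (r : V -> V -> R).
Hypotheses (hr : hermitian_real_part r) (cr : form_complete r).

Lemma invS_lt (e : R) : 0 < e -> exists N, forall n, (N <= n)%N -> n.+1%:R^-1 < e.
Proof.
move=> e0; exists (Num.truncn e^-1) => n Nn.
rewrite invf_plt ?posrE ?ltr0Sn //; apply: lt_le_trans (truncnS_gt _) _.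
by rewrite ler_nat.
Qed.

(* The representing vector minimizes r x x - 2 f x. *)
Lemma riesz_representation (f : V -> R) (M : R) :
  (forall x y, f (x + y) = f x + f y) ->
  (forall (a : R) x, f (a%:C *: x) = a * f x) ->
  0 <= M -> (forall x, f x ^+ 2 <= M * r x x) ->
  exists z, forall x, f x = r x z.
Proof.
move=> fD fZ M0 fM; pose q x := r x x - 2 * f x.
have qM x : - M <= q x.
  (* This is the inequality of arithmetic and geometric means for [r x x] and [M], squared to avoid
     a square root. *)
  have h : (2 * f x) ^+ 2 <= (r x x + M) ^+ 2.
    have -> : (2 * f x) ^+ 2 = 4 * f x ^+ 2 by ring.
    have := fM x; have := sqr_ge0 (r x x - M); nra.
  have : 2 * f x <= r x x + M.
    apply: le_trans (ler_norm _) _; rewrite -ler_sqr ?nnegrE //.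
      by rewrite real_normK ?num_real.
    by rewrite addr_ge0 // hrp_ge0.
  rewrite /q; lra.
pose d := inf (range q).
have hd : has_inf (range q).
  by split; [exists (q 0), 0|exists (- M) => _ [x _ <-]].
have dq x : d <= q x by apply: ge_inf; [case: hd|exists x].
have /choice[u qu] : forall n, exists x, q x < d + n.+1%:R^-1.
  move=> n; have n0 : 0 < n.+1%:R^-1 :> R by rewrite invr_gt0 ltr0Sn.
  by have [_ [x _ <-] xd] := inf_adherent n0 hd; exists x.
(* The midpoint value of [q] is at least [d], so this identity makes every minimizing sequence
   Cauchy. *)
have parallelogram x y :
    r (x - y) (x - y) = 2 * q x + 2 * q y - 4 * q ((2^-1)%:C *: (x + y)).
  rewrite /q fZ fD (hrpZ hr) (hrpZr hr) (hrp_sqB hr) (hrp_sqD hr); by field.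
have [|l ul] := @cr u.
  move=> e e0; have [|N uN] := @invS_lt (e / 4); first by lra.
  exists N => n k /uN nN /uN kN; rewrite parallelogram.
  move: (qu n) (qu k) (dq ((2^-1)%:C *: (u n + u k))) nN kN.
  by move: (q _) (q _) (q _) (_^-1) (_^-1) => *; lra.
exists l => x.
have [x0|x0] := eqVneq (r x x) 0.
  have := fM x; rewrite x0 mulr0 (hrp_eq0 hr x0) (hrp0l hr) => h.
  by apply/eqP; rewrite -sqrf_eq0 eq_le h sqr_ge0.
have {x0} s0 : 0 < r x x by rewrite lt_def x0 hrp_ge0.
set s := r x x in s0 *.
(* Comparing [q] at [u n + t x] with its value at [u n] leaves a quadratic in [t] that is
   nonnegative for all [t]; evaluating it at its minimizer gives the bound. *)
have bound n : (r (u n) x - f x) ^+ 2 <= s * n.+1%:R^-1.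
  have qt t : 0 <= t ^+ 2 * s + 2 * t * (r (u n) x - f x) + n.+1%:R^-1.
    move: (dq (u n + t%:C *: x)) (qu n).
    rewrite /q fD fZ (hrp_sqD hr) (hrpZr hr) (hrpZ hr) (hrpZr hr) -/s.
    by move: (_^-1) => e; lra.
  pose t := - (r (u n) x - f x) / s; move: (qt t).
  have -> : t ^+ 2 * s + 2 * t * (r (u n) x - f x)
      = - ((r (u n) x - f x) ^+ 2 / s) by rewrite /t; field; lra.
  by rewrite addrC subr_ge0 ler_pdivrMr // mulrC.
apply/eqP/negPn/negP; rewrite -subr_eq0 -sqrf_eq0 => D0.
have {D0} D0 : 0 < (f x - r x l) ^+ 2 by rewrite lt_def D0 sqr_ge0.
set D := (f x - r x l) ^+ 2 in D0.
(* With this threshold both squared errors are at most [D / 8], so [D <= D / 2], which contradicts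
   [0 < D]. *)
have e0 : 0 < D / (8 * s) by rewrite divr_gt0 // mulr_gt0.
have [N1 hN1] := invS_lt e0; have [N2 hN2] := ul _ e0.
pose n := maxn N1 N2.
have := hN1 n (leq_maxl _ _); have := hN2 n (leq_maxr _ _).
have := bound n; have := hrp_CauchySchwarz hr (u n - l) x.
rewrite -/s (hrpD hr _ _ x) (hrpN hr _ x) (hrpC hr x l) => h1 h2 h3 h4.
have De : s * (D / (8 * s)) = D / 8 by field; lra.
have h5 : s * n.+1%:R^-1 <= D / 8 by rewrite -De ler_pM2l // ltW.
have h6 : r (u n - l) (u n - l) * s <= D / 8 by rewrite mulrC -De ler_pM2l // ltW.
have h7 : D <= 2 * (r (u n) x - f x) ^+ 2 + 2 * (r (u n) x - r x l) ^+ 2.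
  by rewrite /D; have := sqr_ge0 (r (u n) x - f x + (r (u n) x - r x l)); nra.
have {h2} h2 := le_trans h2 h5; have {h1} h1 := le_trans h1 h6.
have absurd (c a b : R) : 0 < c -> c <= 2 * a + 2 * b -> a <= c / 8 -> b <= c / 8 ->
  False by lra.
exact: absurd D0 h7 h2 h1.
Qed.

Lemma adjoint_exists (T : V -> V) (M : R) : is_linear_map T -> 0 <= M ->
  (forall x, r (T x) (T x) <= M * r x x) ->
  exists Ta : V -> V, forall x y, r (T x) y = r x (Ta y).
Proof.
move=> lT M0 TM.
suff : forall y, exists z, forall x, r (T x) y = r x z.
  by move=> /choice[Ta hTa]; exists Ta => x y; exact: hTa.
move=> y; apply: (@riesz_representation _ (M * r y y)).
- by move=> x z; rewrite (linear_mapD lT) hrpD.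
- by move=> a x; rewrite (linear_mapZ lT) hrpZ.
- by rewrite mulr_ge0 // hrp_ge0.
- move=> x; apply: le_trans (hrp_CauchySchwarz hr _ _) _.
  by rewrite mulrAC ler_wpM2r ?hrp_ge0.
Qed.

End Riesz.

(** * Weighted sequence spaces and their shift *)

(** Imaginary parts follow from real parts because [T] commutes with multiplication by ['i]. *)
Lemma is_adjoint_ip_of_form (R : realType) (V : lmodType R[i]) (r : V -> V -> R)
    (T Ta : V -> V) : hermitian_real_part r -> is_linear_map T ->
  (forall x y, r (T x) y = r x (Ta y)) -> is_adjoint (ip_of_form r) T Ta.
Proof.
move=> hr lT TTa x y; rewrite /ip_of_form TTa; congr (_ +i* _).
by rewrite !(hrp_ir hr) -(linear_mapZ lT) TTa.
Qed.

Section WeightedL2.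
Variables (R : realType) (V : lmodType R[i]) (r : V -> V -> R).

(* The two proofs are arguments of the predicate only so that its closure under
   linear combinations can be registered as a canonical structure. *)
Definition wl2_pred (hr : hermitian_real_part r) (w : nat -> R)
    (w_gt0 : forall n, 0 < w n) : {pred (nat -> V)} :=
  fun x => `[< abs_summable (fun n => w n * r (x n) (x n)) >].

Section Closed.
Variables (hr : hermitian_real_part r) (w : nat -> R) (w_gt0 : forall n, 0 < w n).

Lemma wl2P x : reflect (abs_summable (fun n => w n * r (x n) (x n)))
  (x \in wl2_pred hr w_gt0).
Proof. exact: asboolP. Qed.

Lemma weighted_norm_ge0 (x : nat -> V) n : 0 <= w n * r (x n) (x n).
Proof. by rewrite mulr_ge0 ?hrp_ge0 // ltW. Qed.

Lemma wl2_series x : x \in wl2_pred hr w_gt0 ->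
  cvgn (series (fun n => w n * r (x n) (x n))).
Proof. by move=> /wl2P; exact: abs_summable_cvg. Qed.

Lemma wl2_intro x (u : nat -> R) : (forall n, w n * r (x n) (x n) <= u n) ->
  cvgn (series u) -> x \in wl2_pred hr w_gt0.
Proof.
move=> xu cu; apply/wl2P; apply: abs_summable_le cu => n.
by rewrite ger0_norm ?weighted_norm_ge0.
Qed.

Lemma wl2_submod_closed : submod_closed (wl2_pred hr w_gt0).
Proof.
split=> [|a x y /wl2_series xs /wl2_series ys].
  apply: (@wl2_intro _ (fun=> 0)) => [n|]; first by rewrite (hrp0l hr) mulr0.
  by apply: (@nonneg_series_bounded_cvg _ _ 0) => // n; rewrite seriesEord /= big1.
pose c := 2 * (complex.Re a ^+ 2 + complex.Im a ^+ 2).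
apply: (@wl2_intro _ (fun n => c * (w n * r (x n) (x n)) + 2 * (w n * r (y n) (y n)))).
  move=> n; rewrite mulrCA [2 * _]mulrCA -mulrDr ler_pM2l //.
  apply: le_trans (hrp_sqD_le hr _ _) _.
  by rewrite (hrp_scale_complex hr) mulrA.
by apply: is_cvg_seriesD; exact: cvg_seriesM.
Qed.

HB.instance Definition _ := GRing.isSubmodClosed.Build R[i] (nat -> V)
  (wl2_pred hr w_gt0) wl2_submod_closed.

Record wl2 := WL2 { wl2_val : nat -> V; _ : wl2_val \in wl2_pred hr w_gt0 }.

HB.instance Definition _ := [isSub for wl2_val].
HB.instance Definition _ := [Choice of wl2 by <:].
HB.instance Definition _ := [SubChoice_isSubLmodule of wl2 by <:].

Hypothesis cr : form_complete r.
Local Notation K := wl2.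
Implicit Types x y z : K.

Lemma wl2_valD x y n : wl2_val (x + y) n = wl2_val x n + wl2_val y n.
Proof. by rewrite -[wl2_val _]/(val (x + y)) raddfD. Qed.

Lemma wl2_valZ (a : R[i]) x n : wl2_val (a *: x) n = a *: wl2_val x n.
Proof. by rewrite -[wl2_val _]/(val (a *: x)) linearZ. Qed.

Lemma wl2_valN x n : wl2_val (- x) n = - wl2_val x n.
Proof. by rewrite -[in LHS]scaleN1r wl2_valZ scaleN1r. Qed.

Lemma wl2_val0 n : wl2_val (0 : K) n = 0.
Proof. by rewrite -(scale0r (0 : K)) wl2_valZ scale0r. Qed.

Lemma wl2_val_sum m (f : 'I_m -> K) n :
  wl2_val (\sum_(i < m) f i) n = \sum_(i < m) wl2_val (f i) n.
Proof.
apply: (big_morph (fun x : K => wl2_val x n)) => [x y|].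
  exact: wl2_valD.
exact: wl2_val0.
Qed.

Lemma wl2_ext x y : (forall n, wl2_val x n = wl2_val y n) -> x = y.
Proof. by move=> xy; apply: val_inj; apply/funext. Qed.

Lemma wl2_sq_cvg x : cvgn (series (fun n => w n * r (wl2_val x n) (wl2_val x n))).
Proof. exact: wl2_series (valP x). Qed.

Lemma wl2_summable x y :
  abs_summable (fun n => w n * r (wl2_val x n) (wl2_val y n)).
Proof.
apply: (@abs_summable_le _ _ (fun n => 2^-1 *
   (w n * r (wl2_val x n) (wl2_val x n) + w n * r (wl2_val y n) (wl2_val y n)))).
  move=> n; rewrite normrM (gtr0_norm (w_gt0 n)) -mulrDr mulrCA ler_pM2l //.
  by rewrite mulrC hrp_norm_le.
apply: cvg_seriesM; apply: is_cvg_seriesD; exact: wl2_sq_cvg.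
Qed.

Definition wl2_form x y := rsum (fun n => w n * r (wl2_val x n) (wl2_val y n)).

Lemma wl2_partial_le x n :
  \sum_(i < n) w i * r (wl2_val x i) (wl2_val x i) <= wl2_form x x.
Proof.
by apply: (@series_le_rsum _ (fun i => w i * r (wl2_val x i) (wl2_val x i)));
  [move=> k; exact: weighted_norm_ge0|exact: wl2_sq_cvg].
Qed.

Lemma wl2_coord_le x n : w n * r (wl2_val x n) (wl2_val x n) <= wl2_form x x.
Proof.
apply: le_trans (wl2_partial_le x n.+1); rewrite big_ord_recr /= lerDr.
by apply: sumr_ge0 => i _; exact: weighted_norm_ge0.
Qed.

Lemma wl2_form_hermitian : hermitian_real_part wl2_form.
Proof.
split=> [x y z|a x z|x y|x y|x|x x0].
- rewrite /wl2_form -rsumD; [|exact: wl2_summable..].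
  by congr rsum; apply/funext => n; rewrite wl2_valD hrpD // mulrDr.
- rewrite /wl2_form -rsumZ; last exact: wl2_summable.
  by congr rsum; apply/funext => n; rewrite wl2_valZ hrpZ // mulrCA.
- by congr rsum; apply/funext => n; rewrite (hrpC hr).
- by congr rsum; apply/funext => n; rewrite !wl2_valZ hrpi.
- by have := wl2_partial_le x 0; rewrite big_ord0.
- apply: wl2_ext => n; rewrite wl2_val0; apply: (hrp_eq0 hr); apply/eqP.
  rewrite eq_le hrp_ge0 // andbT; have := wl2_coord_le x n.
  by rewrite x0 pmulr_rle0.
Qed.

(** The limit is taken coordinatewise. Finite partial sums of the squared distances pass to the
    limit, which yields both membership in the space and convergence in norm. *)
Lemma wl2_form_complete : form_complete wl2_form.
Proof.
move=> u uC.
have valB n k i : wl2_val (u n - u k) i = wl2_val (u n) i - wl2_val (u k) i.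
  by rewrite wl2_valD wl2_valN.
have /choice[l ul] : forall i, exists l, forall e : R, 0 < e ->
    exists N, forall n, (N <= n)%N -> r (wl2_val (u n) i - l) (wl2_val (u n) i - l) < e.
  move=> i; apply: cr => e e0; have [|N uN] := uC (w i * e); first exact: mulr_gt0.
  exists N => n k nN kN; have := uN n k nN kN.
  by move=> /(le_lt_trans (wl2_coord_le _ i)); rewrite valB ltr_pM2l.
have cl n i : (fun k => w i * r (wl2_val (u n - u k) i) (wl2_val (u n - u k) i)) @ \oo
   --> w i * r (wl2_val (u n) i - l i) (wl2_val (u n) i - l i).
  apply: cvgM; first exact: cvg_cst.
  set t := wl2_val (u n) i - l i; pose v k := wl2_val (u k) i - l i.
  have v0 : (fun k => r (v k) (v k)) @ \oo --> (0 : R).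
    apply/cvgrPdist_lt => e e0; have [N uN] := ul i e e0; exists N => // k /= /uN.
    by rewrite sub0r normrN ger0_norm // hrp_ge0.
  have tv0 : (fun k => r t (v k)) @ \oo --> (0 : R).
    apply/cvgrPdist_lt => e e0.
    (* The added 1 keeps the denominator positive when [r t t = 0]. *)
    have d0 : 0 < e ^+ 2 / (r t t + 1).
      by rewrite divr_gt0 ?exprn_gt0 // ltr_wpDl // hrp_ge0.
    have [N uN] := ul i _ d0; exists N => // k /= /uN.
    rewrite -/(v k) ltr_pdivlMr ?ltr_wpDl ?hrp_ge0 // => vk.
    rewrite sub0r normrN -[X in _ < X](gtr0_norm e0) -ltr_sqr ?nnegrE //.
    rewrite !real_normK ?num_real //.
    apply: le_lt_trans (hrp_CauchySchwarz hr _ _) (le_lt_trans _ vk).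
    by rewrite mulrC ler_wpM2l ?hrp_ge0 // lerDl.
  have -> : (fun k => r (wl2_val (u n - u k) i) (wl2_val (u n - u k) i))
      = (fun k => r t t - 2 * r t (v k) + r (v k) (v k)).
    apply/funext => k; rewrite -(hrp_sqB hr) valB.
    by rewrite /t /v opprB addrA subrK.
  rewrite [X in _ --> X](_ : _ = r t t - 2 * 0 + 0); last first.
    by rewrite mulr0 subr0 addr0.
  apply: cvgD => //; apply: cvgB; first exact: cvg_cst.
  by apply: cvgM => //; exact: cvg_cst.
have tail e N : (forall n k, (N <= n)%N -> (N <= k)%N -> wl2_form (u n - u k) (u n - u k) < e) ->
    forall n m, (N <= n)%N ->
    \sum_(i < m) w i * r (wl2_val (u n) i - l i) (wl2_val (u n) i - l i) <= e.
  move=> uN n m nN.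
  have cs : (fun k => \sum_(i < m) w i * r (wl2_val (u n - u k) i) (wl2_val (u n - u k) i))
      @ \oo --> \sum_(i < m) w i * r (wl2_val (u n) i - l i) (wl2_val (u n) i - l i).
    by apply: cvg_big => [|i _]; [exact: add_continuous|exact: cl].
  rewrite -(cvg_lim _ cs) //; apply: limr_le; first by apply/cvg_ex; eexists; exact: cs.
  exists N => // k kN; apply/ltW; apply: le_lt_trans (uN n k nN kN).
  exact: wl2_partial_le.
have [N1 uN1] := uC 1 ltr01.
(* The coordinatewise limit [l] is not yet known to be in the space, but its difference from [u N1]
   is; the limit is then built as [u N1] minus that difference. *)
have wdl : (fun i => wl2_val (u N1) i - l i) \in wl2_pred hr w_gt0.
  apply: wl2_intro => // [n|]; first exact: lexx.
  apply: (@nonneg_series_bounded_cvg _ _ 1) => [n|n].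
    exact: (weighted_norm_ge0 (fun i => wl2_val (u N1) i - l i)).
  by rewrite seriesEord; exact: (tail 1 N1).
exists (u N1 - WL2 wdl) => e e0.
have [|N uN] := uC (e / 2); first by rewrite divr_gt0.
exists N => n nN; apply: (@le_lt_trans _ _ (e / 2)); last by lra.
have dE i : wl2_val (u n - (u N1 - WL2 wdl)) i = wl2_val (u n) i - l i.
  by rewrite !(wl2_valD, wl2_valN) /= (subKr (wl2_val (u N1) i)).
apply: rsum_le; first exact: wl2_sq_cvg.
by move=> m; under eq_bigr do rewrite dE; exact: tail uN n m nN.
Qed.

End Closed.
End WeightedL2.

(** * Finite differences of polynomials *)

Lemma alternating_pascal (A : pzRingType) (f : nat -> A) N :
  \sum_(j < N.+2) (-1) ^+ j * 'C(N.+1, j)%:R * f j =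
  \sum_(j < N.+1) (-1) ^+ j * 'C(N, j)%:R * (f j - f j.+1).
Proof.
under [RHS]eq_bigr do rewrite mulrBr.
rewrite sumrB big_ord_recl [X in _ = X - _]big_ord_recl !bin0 -addrA; congr (_ + _).
rewrite (eq_bigr (fun j : 'I_N.+1 => (-1) ^+ j.+1 * 'C(N, j.+1)%:R * f j.+1
    - (-1) ^+ j * 'C(N, j)%:R * f j.+1)); last first.
  move=> j _; rewrite lift0 binS natrD mulrDr mulrDl; congr (_ + _).
  by rewrite exprS mulN1r !mulNr.
rewrite sumrB; congr (_ - _).
by rewrite big_ord_recr /= bin_small // mulr0 mul0r addr0.
Qed.

(** Pascal's rule moves one difference onto the power, and the first difference of a power of degree
    [d] only involves degrees below [d], so induction on [N] applies. *)
Lemma alternating_binomial_sum_expr (A : comPzRingType) N d n : (d < N)%N ->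
  \sum_(j < N.+1) (-1) ^+ j * 'C(N, j)%:R * (n + j)%:R ^+ d = 0 :> A.
Proof.
elim: N d => // N IH d dN.
rewrite (alternating_pascal (fun j => (n + j)%:R ^+ d)).
have diff j : (n + j)%:R ^+ d - (n + j.+1)%:R ^+ d =
    - \sum_(i < d) 'C(d, i)%:R * (n + j)%:R ^+ i :> A.
  rewrite addnS -nat1r exprDn big_ord_recr /= subnn expr0 mul1r binn mulr1n.
  under eq_bigr do rewrite expr1n mul1r -mulr_natl.
  by rewrite opprD addrCA subrr addr0.
under eq_bigr do rewrite diff mulrN mulr_sumr.
rewrite sumrN exchange_big /= big1 ?oppr0 // => i _.
under eq_bigr do rewrite mulrCA.
by rewrite -mulr_sumr IH ?mulr0 // (leq_trans (ltn_ord i)).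
Qed.

(** * The forward shift and its adjoint *)

Section WeightedShift.
Variables (R : realType) (V : lmodType R[i]) (r : V -> V -> R) (w : nat -> R).
Hypotheses (hr : hermitian_real_part r) (w_gt0 : forall n, 0 < w n).
Variable c : R.
Hypothesis w_le : forall n, w n.+1 <= c * w n.
Local Notation K := (wl2 hr w_gt0).
Local Notation form := (@wl2_form _ _ _ hr _ w_gt0).
Implicit Types x y : K.

Let c_ge0 : 0 <= c.
Proof.
by have := lt_le_trans (w_gt0 1) (w_le 0); rewrite pmulr_lgt0 // => /ltW.
Qed.

Definition shift_seq (u : nat -> V) : nat -> V := fun n => if n is k.+1 then u k else 0.

(** The ratio of weights makes this the adjoint of the shift for the weighted form. *)
Definition back_seq (u : nat -> V) : nat -> V :=
  fun n => (w n.+1 / w n)%:C *: u n.+1.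

Lemma shift_seq_wl2 x : shift_seq (wl2_val x) \in wl2_pred hr w_gt0.
Proof.
apply: wl2_intro => [n|]; first exact: lexx.
apply/cvg_ex; eexists; apply: cvg_seriesS.
apply: (@abs_summable_cvg _ (fun n => w n.+1 * r (wl2_val x n) (wl2_val x n))).
apply: (@abs_summable_le _ _ (fun n => c * (w n * r (wl2_val x n) (wl2_val x n))));
  last by apply: cvg_seriesM; exact: wl2_sq_cvg.
move=> n; rewrite mulrA ger0_norm; first by rewrite ler_wpM2r ?hrp_ge0.
by rewrite mulr_ge0 ?hrp_ge0 // ltW.
Qed.

Lemma back_seq_wl2 x : back_seq (wl2_val x) \in wl2_pred hr w_gt0.
Proof.
have sx : abs_summable (fun n => w n.+1 * r (wl2_val x n.+1) (wl2_val x n.+1)).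
  apply: (@abs_summableS _ (fun n => w n * r (wl2_val x n) (wl2_val x n))).
  exact: wl2_summable.
apply: (@wl2_intro _ _ _ _ _ _ _
  (fun n => c * (w n.+1 * r (wl2_val x n.+1) (wl2_val x n.+1)))); last first.
  by apply: cvg_seriesM; exact: abs_summable_cvg sx.
move=> n.
rewrite /back_seq (hrpZ hr) (hrpZr hr); set s := r _ _.
rewrite (_ : w n * _ = w n.+1 / w n * (w n.+1 * s)); last first.
  by field; rewrite gt_eqF.
apply: ler_wpM2r; last by rewrite ler_pdivrMr.
by rewrite mulr_ge0 ?hrp_ge0 // ltW.
Qed.

Definition wshift x : K := WL2 (shift_seq_wl2 x).
Definition wback x : K := WL2 (back_seq_wl2 x).

Lemma wshift_linear : is_linear_map wshift.
Proof.
move=> a x y; apply: wl2_ext => -[|n]; rewrite wl2_valD wl2_valZ.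
  by rewrite /= scaler0 addr0.
by rewrite -[LHS]/(wl2_val (a *: x + y) n) wl2_valD wl2_valZ.
Qed.

Lemma wshift_form x y :
  form (wshift x) (wshift y) = rsum (fun n => w n.+1 * r (wl2_val x n) (wl2_val y n)).
Proof.
rewrite /wl2_form rsumS /=; first by rewrite (hrp0l hr) mulr0 add0r.
apply: (@abs_summableS _ (fun n =>
  w n * r (wl2_val (wshift x) n) (wl2_val (wshift y) n))).
exact: wl2_summable.
Qed.

Lemma wshift_sq_cvg x :
  cvgn (series (fun n => w n.+1 * r (wl2_val x n) (wl2_val x n))).
Proof.
apply: abs_summable_cvg; apply: (@abs_summableS _ (fun n =>
  w n * r (wl2_val (wshift x) n) (wl2_val (wshift x) n))).
exact: wl2_summable.
Qed.

Lemma wshift_form_le x : form (wshift x) (wshift x) <= c * form x x.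
Proof.
rewrite wshift_form /wl2_form -rsumZ; last exact: wl2_summable.
apply: ler_rsum; [exact: wshift_sq_cvg|by apply: cvg_seriesM; exact: wl2_sq_cvg|].
by move=> n; rewrite mulrA ler_wpM2r ?hrp_ge0.
Qed.

Lemma wshift_form_ge x : (forall n, w n <= w n.+1) ->
  form x x <= form (wshift x) (wshift x).
Proof.
move=> w_nd; rewrite wshift_form; apply: ler_rsum; [exact: wl2_sq_cvg|exact: wshift_sq_cvg|].
by move=> n; rewrite ler_wpM2r ?hrp_ge0.
Qed.

Lemma wshift_back_form x y : form (wshift x) y = form x (wback y).
Proof.
rewrite {1}/wl2_form rsumS /=; last first.
  apply: (@abs_summableS _ (fun n => w n * r (wl2_val (wshift x) n) (wl2_val y n))).
  exact: wl2_summable.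
rewrite (hrp0l hr) mulr0 add0r; congr rsum; apply/funext => n.
by rewrite /= /back_seq (hrpZr hr); field; rewrite gt_eqF.
Qed.

Lemma wshift_adjoint : is_adjoint (ip_of_form form) wshift wback.
Proof.
apply: is_adjoint_ip_of_form; [exact: wl2_form_hermitian|exact: wshift_linear|].
exact: wshift_back_form.
Qed.

Lemma wshift_bounded : bounded_op (ip_of_form form) wshift.
Proof.
split; first exact: wshift_linear.
exists (Num.sqrt c) => x; rewrite !hnorm_ip_of_form -sqrtrM //.
by rewrite ler_wsqrtr // wshift_form_le.
Qed.

Lemma wshift_expansive : (forall n, w n <= w n.+1) ->
  expansive (ip_of_form form) wshift.
Proof. by move=> w_nd x; rewrite !hnorm_ip_of_form ler_wsqrtr // wshift_form_ge. Qed.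

Lemma iter_wshift_lt j x n : (n < j)%N -> wl2_val (iter j wshift x) n = 0.
Proof. by elim: j n => // j IH [|n] //= nj; rewrite IH. Qed.

Lemma iter_wshift_add j x n : wl2_val (iter j wshift x) (j + n) = wl2_val x n.
Proof. by elim: j. Qed.

Lemma wshift_analytic : analytic wshift.
Proof.
move=> x hx; apply: wl2_ext => n; rewrite wl2_val0.
by have [y ->] := hx n.+1; rewrite iter_wshift_lt.
Qed.

Lemma iter_wback j x n :
  wl2_val (iter j wback x) n = (w (j + n) / w n)%:C *: wl2_val x (j + n)%N.
Proof.
elim: j n => [|j IH] n; first by rewrite divff ?scale1r // gt_eqF.
rewrite /= /back_seq IH scalerA -rmorphM /= addnS; congr (_ %:C *: _).
by field; rewrite !gt_eqF.
Qed.

(** [S^{*j} S^j] multiplies coordinate [n] by [w (n + j) / w n], so the operator identity reduces to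
    the vanishing of the differences of order [N] of the weights. *)
Lemma wshift_m_isometric N :
  (forall n, \sum_(j < N.+1) (-1) ^+ j * 'C(N, j)%:R * w (n + j) = 0) ->
  m_isometric (ip_of_form form) N wshift.
Proof.
move=> wN; exists wback; split=> [|x]; first exact: wshift_adjoint.
apply: wl2_ext => n; rewrite wl2_val0 wl2_val_sum.
transitivity (((\sum_(j < N.+1) (-1) ^+ j * 'C(N, j)%:R * w (n + j)) / w n)%:C
  *: wl2_val x n).
  rewrite mulr_suml rmorph_sum scaler_suml; apply: eq_bigr => j _.
  rewrite wl2_valZ iter_wback iter_wshift_add scalerA addnC -[in RHS]mulrA.
  by rewrite !rmorphM rmorphXn rmorphN rmorph1 rmorph_nat.
by rewrite wN mul0r scale0r.
Qed.

End WeightedShift.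

(** * The weights and the inverse power series *)

Section SeriesInverse.
Variables (R : realType) (k : nat -> R).

(* The first argument is fuel; the recursion is over all smaller indices. *)
Fixpoint inv_coef_rec (fuel n : nat) : R :=
  if fuel is f.+1 then
    if n is p.+1 then - \sum_(i < n) k i.+1 * inv_coef_rec f (p - i) else 1
  else 0.

Definition inv_coef n := inv_coef_rec n.+1 n.

Lemma inv_coef_recS f p : inv_coef_rec f.+1 p.+1 =
  - \sum_(i < p.+1) k i.+1 * inv_coef_rec f (p - i).
Proof. by []. Qed.

Lemma inv_coef_recE f n : (n < f)%N -> inv_coef_rec f n = inv_coef n.
Proof.
(* Induction on a bound [F] for the fuel, since the two sides recurse with different fuels and both
   must be compared with [inv_coef]. *)
rewrite /inv_coef; elim: f {-2}f (leqnn f) n => [|F IH] [|f] // fF [|n] // nf.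
rewrite !inv_coef_recS; congr (- _); apply: eq_bigr => i _; congr (_ * _).
have ni : (n - i <= n)%N by exact: leq_subr.
rewrite IH //; last exact: leq_ltn_trans ni _.
by rewrite [in RHS]IH //; lia.
Qed.

Lemma inv_coef0 : inv_coef 0 = 1. Proof. by []. Qed.

Lemma inv_coefS n : inv_coef n.+1 = - \sum_(i < n.+1) k i.+1 * inv_coef (n - i).
Proof.
rewrite {1}/inv_coef inv_coef_recS; congr (- _); apply: eq_bigr => i _.
by congr (_ * _); apply: inv_coef_recE; rewrite ltnS leq_subr.
Qed.

Lemma inv_coef_convolution p : k 0%N = 1 ->
  \sum_(i < p.+1) k i * inv_coef (p - i) = (p == 0)%:R.
Proof.
move=> k0; rewrite big_ord_recl subn0 k0 mul1r; case: p => [|p].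
  by rewrite big_ord0 addr0.
rewrite inv_coefS; under [X in _ + X]eq_bigr do rewrite lift0 subSS.
by rewrite addNr.
Qed.

(** The recursion and the submultiplicativity of [nu] give [S <= d * (1 + S)] for each partial sum
    [S]; as [d <= 1/2], the term [d * S] is absorbed. *)
Lemma inv_coef_bound (nu : nat -> R) (d : R) :
  (forall n, 0 <= nu n) -> nu 0%N = 1 -> (forall i j, nu (i + j)%N <= nu i * nu j) ->
  d <= 2^-1 -> (forall N, \sum_(i < N) `|k i.+1| * nu i.+1 <= d) ->
  forall N, \sum_(n < N) `|inv_coef n.+1| * nu n.+1 <= 2 * d.
Proof.
move=> nu0 nu1 nuM d_le kd N; pose gam n := `|inv_coef n| * nu n.
have gam0 n : 0 <= gam n by rewrite mulr_ge0.
have d0 : 0 <= d by have := kd 0; rewrite big_ord0.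
set S := \sum_(n < N) _; have S0 : 0 <= S by apply: sumr_ge0 => n _; exact: gam0.
suff SE : S <= d * (1 + S) by have := mulr_ge0 d0 S0; nra.
apply: (@le_trans _ _ (\sum_(n < N) \sum_(i < n.+1)
    `|k i.+1| * nu i.+1 * gam (n - i)%N)).
  apply: ler_sum => n _; rewrite inv_coefS normrN.
  apply: (@le_trans _ _
    ((\sum_(i < n.+1) `|k i.+1 * inv_coef (n - i)|) * nu n.+1)).
    by rewrite ler_wpM2r // ler_norm_sum.
  rewrite mulr_suml; apply: ler_sum => i _; rewrite normrM.
  have -> : `|k i.+1| * nu i.+1 * gam (n - i)%N
     = `|k i.+1| * `|inv_coef (n - i)| * (nu i.+1 * nu (n - i)%N).
    by rewrite /gam; ring.
  rewrite ler_wpM2l ?mulr_ge0 //; apply: le_trans (nuM _ _).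
  by rewrite addSn subnKC // -ltnS.
(* The triangle is enlarged to a rectangle, where the sum factors; the 1 in [1 + S] is [gam 0]. *)
rewrite -(antidiagonal_sum (fun i j => `|k i.+1| * nu i.+1 * gam j)).
apply: (@le_trans _ _ ((\sum_(i < N) `|k i.+1| * nu i.+1) * (1 + S))); last first.
  by rewrite ler_wpM2r // addr_ge0.
rewrite mulr_suml; apply: ler_sum => i _; rewrite -mulr_sumr.
rewrite ler_wpM2l ?mulr_ge0 //.
have -> : 1 + S = \sum_(j < N.+1) gam j.
  by rewrite big_ord_recl /gam inv_coef0 normr1 nu1 mulr1.
rewrite -(subnKC (leq_trans (leq_subr i N) (leqnSn N))) big_split_ord /=.
by rewrite lerDl sumr_ge0.
Qed.

End SeriesInverse.

Section Weights.
Variable R : realType.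

Lemma sum_inv_sqr_le N : \sum_(i < N) (i.+1%:R ^+ 2)^-1 <= 2 :> R.
Proof.
case: N => [|N]; first by rewrite big_ord0.
(* The sharper bound, unlike the bound 2, is preserved by induction. *)
apply: (@le_trans _ _ (2 - N.+1%:R^-1)); last by rewrite gerBl invr_ge0.
elim: N => [|N IH]; first by rewrite big_ord1 expr1n invr1; lra.
rewrite big_ord_recr /=; apply: le_trans (lerD IH (lexx _)) _.
have a0 : 0 < N.+1%:R :> R by rewrite ltr0Sn.
rewrite -(natr1 N.+1) -subr_ge0; move: a0; move: N.+1%:R => a a0.
have -> : 2 - (a + 1)^-1 - (2 - a^-1 + ((a + 1) ^+ 2)^-1) = (a * (a + 1) ^+ 2)^-1.
  by field; rewrite !gt_eqF // ltr_wpDl // ltW.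
by rewrite invr_ge0 mulr_ge0 ?sqr_ge0 // ltW.
Qed.

Variables (m : nat) (L : R).
Hypothesis L_ge1 : 1 <= L.

(** The exponent exceeds the growth exponent [m] by two, so [growth_weight n / poly_weight n] is
    summable, and is below [m + 3], so differences of that order vanish. The 1 normalizes the weight
    at 0. *)
Definition poly_weight n : R := 1 + L * n%:R ^+ (m + 2).
(** Using [n.+1] makes the weight positive at 0 and submultiplicative, since
    [i + j + 1 <= (i + 1) (j + 1)]. *)
Definition growth_weight n : R := n.+1%:R ^+ m.

Lemma poly_weight0 : poly_weight 0 = 1.
Proof. by rewrite /poly_weight addn2 expr0n mulr0 addr0. Qed.

Lemma poly_weight_gt0 n : 0 < poly_weight n.
Proof.
by rewrite ltr_wpDr // mulr_ge0 ?exprn_ge0 // (le_trans ler01).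
Qed.

Lemma poly_weight_nd n : poly_weight n <= poly_weight n.+1.
Proof.
rewrite lerD2l ler_wpM2l ?(le_trans ler01) //.
by rewrite lerXn2r ?nnegrE // ler_nat.
Qed.

Lemma exprS_le n d : n.+1%:R ^+ d <= 2 ^+ d * (1 + n%:R ^+ d) :> R.
Proof.
case: n => [|n].
  rewrite expr1n; apply: (@le_trans _ _ (2 ^+ d)); first by rewrite exprn_ege1 // ler1n.
  by rewrite ler_peMr ?exprn_ge0 // lerDl exprn_ge0.
rewrite mulrDr mulr1 -exprMn -[leLHS]add0r lerD ?exprn_ge0 //.
rewrite lerXn2r ?nnegrE ?mulr_ge0 // -natrM ler_nat; lia.
Qed.

(** Bounded ratios of consecutive weights are what makes the shift a bounded operator. *)
Lemma poly_weight_le n :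
  poly_weight n.+1 <= (1 + L * 2 ^+ (m + 2)) * poly_weight n.
Proof.
have := @exprS_le n (m + 2); rewrite /poly_weight.
have a0 : 0 <= n%:R ^+ (m + 2) :> R by exact: exprn_ge0.
have b0 : 0 <= 2 ^+ (m + 2) :> R by exact: exprn_ge0.
move: a0 b0; move: (n%:R ^+ _) (2 ^+ _) (n.+1%:R ^+ _) => a b c a0 b0 h.
have h1 : L * c <= L * (b * (1 + a)) by rewrite ler_wpM2l // (le_trans ler01).
have h2 : 0 <= L * (b * a) * (L - 1).
  by rewrite mulr_ge0 ?mulr_ge0 ?subr_ge0 // (le_trans ler01).
have h3 : 0 <= L * a by rewrite mulr_ge0 // (le_trans ler01).
lra.
Qed.

Lemma growth_weightM i j :
  growth_weight (i + j) <= growth_weight i * growth_weight j.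
Proof.
rewrite -exprMn lerXn2r ?nnegrE ?mulr_ge0 // -natrM ler_nat; lia.
Qed.

Lemma growth_poly_weight n :
  (poly_weight n.+1)^-1 * growth_weight n.+1 <= 2 ^+ m / L * (n.+1%:R ^+ 2)^-1.
Proof.
have a0 : 0 < n.+1%:R :> R by rewrite ltr0Sn.
have L0 : 0 < L by exact: lt_le_trans ltr01 _.
have h : growth_weight n.+1 <= 2 ^+ m * n.+1%:R ^+ m.
  rewrite -exprMn lerXn2r ?nnegrE ?mulr_ge0 // -natrM ler_nat; lia.
apply: (@le_trans _ _ ((L * n.+1%:R ^+ (m + 2))^-1 * (2 ^+ m * n.+1%:R ^+ m))).
  rewrite ler_pM ?invr_ge0 ?exprn_ge0 //; first exact/ltW/poly_weight_gt0.
  rewrite lef_pV2 ?posrE ?poly_weight_gt0 ?mulr_gt0 ?exprn_gt0 //.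
  by rewrite /poly_weight lerDr.
rewrite exprD le_eqVlt; apply/orP; left; apply/eqP.
have := exprn_gt0 m a0; move: a0; move: n.+1%:R (2 ^+ m) (n.+1%:R ^+ m) => a c b.
by move=> a0 b0; field; rewrite !gt_eqF.
Qed.

Lemma sum_growth_poly_weight N :
  \sum_(i < N) `|(poly_weight i.+1)^-1| * growth_weight i.+1 <= 2 ^+ m.+1 / L.
Proof.
apply: (@le_trans _ _ (\sum_(i < N) 2 ^+ m / L * (i.+1%:R ^+ 2)^-1)).
  apply: ler_sum => i _; rewrite ger0_norm ?growth_poly_weight //.
  by rewrite invr_ge0 ltW // poly_weight_gt0.
rewrite -mulr_sumr (exprSr _ m) [leRHS]mulrAC ler_wpM2l ?sum_inv_sqr_le //.
by rewrite divr_ge0 ?exprn_ge0 // (le_trans ler01).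
Qed.

Lemma poly_weight_difference n :
  \sum_(j < (m + 3).+1) (-1) ^+ j * 'C(m + 3, j)%:R * poly_weight (n + j) = 0.
Proof.
under eq_bigr do rewrite /poly_weight mulrDr mulrCA.
rewrite big_split /= -mulr_sumr alternating_binomial_sum_expr ?mulr0 ?addr0; last lia.
by apply: (@alternating_binomial_sum_expr R (m + 3) 0 n); rewrite addn_gt0 orbT.
Qed.

End Weights.

(** * The lifting *)

Section Adjoint.
Variables (R : realType) (V : lmodType R[i]) (r : V -> V -> R).
Hypothesis hr : hermitian_real_part r.
Variables T Ta : V -> V.
Hypothesis lT : is_linear_map T.
Hypothesis TTa : forall x y, r (T x) y = r x (Ta y).

Lemma hrp_scale_conj (a : R[i]) x y : r (a *: x) y = r x (a^* *: y).
Proof.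
rewrite (scale_complexE a) (scale_complexE (a^*)) (hrpD hr) (hrpDr hr).
rewrite (hrp_ir hr) !(hrpZ hr) !(hrpZr hr); case: a => a b /=; congr (_ + _).
have -> t : r ('i *: (b%:C *: x)) t = - (b * r x ('i *: t)).
  by rewrite -(hrpZ hr) (hrp_ir hr) opprK.
by rewrite (hrp_ir hr x); ring.
Qed.

Lemma adjoint_linear : is_linear_map Ta.
Proof.
move=> a y z; apply/eqP; rewrite -subr_eq0; apply/eqP; apply: (hrp_eq0 hr).
set t := (X in r X _); rewrite (hrpDr hr) (hrpNr hr) (hrpDr hr).
rewrite -!TTa (hrpDr hr) -[a]conjcK -!hrp_scale_conj -TTa linear_mapZ //.
by rewrite subrr.
Qed.

Lemma iter_adjoint n x y : r (iter n T x) y = r x (iter n Ta y).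
Proof. by elim: n x => // n IH x; rewrite iterSr IH /= TTa. Qed.

(** With [y = T^{*n} x], Cauchy-Schwarz gives |y|^4 = <T^n y, x>^2 <= M |y|^2 |x|^2, and one factor
    |y|^2 is cancelled. *)
Lemma iter_adjoint_bound n (M : R) : (forall x, r (iter n T x) (iter n T x) <= M * r x x) ->
  forall x, r (iter n Ta x) (iter n Ta x) <= M * r x x.
Proof.
move=> TM x; set y := iter n Ta x.
have [y0|y0] := eqVneq (r y y) 0.
  rewrite y0; apply: le_trans (TM x); exact: hrp_ge0.
have {}y0 : 0 < r y y by rewrite lt_def y0 hrp_ge0.
have e : r (iter n T y) x = r y y by rewrite iter_adjoint.
have := hrp_CauchySchwarz hr (iter n T y) x; rewrite e => h.
have := le_trans h (ler_wpM2r (hrp_ge0 hr x) (TM y)).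
by rewrite expr2 mulrAC ler_pM2r.
Qed.

End Adjoint.

(** * The renormed space and the embedding *)

Section Lifting.
Variables (R : realType) (V : lmodType R[i]) (r : V -> V -> R).
Hypotheses (hr : hermitian_real_part r) (cr : form_complete r).
Variables (A : V -> V) (m : nat) (C : R).
Hypotheses (lA : is_linear_map A) (C_ge1 : 1 <= C).
Hypothesis A_growth : forall n x,
  r (iter n A x) (iter n A x) <= C * growth_weight R m n * r x x.

(** [A] stands for the adjoint of the operator to be lifted. This [L] makes [2 ^+ m.+1 / L] equal to
    [(4 * C)^-1]; inverting the series doubles it to [(2 * C)^-1], and the growth constant [C] turns
    that into the relative perturbation 1/2 of [renormed_close]. *)
Let L := 2 ^+ (m + 3) * C.
Let w := poly_weight m L.
Let k n := (w n)^-1.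
Let g := inv_coef k.
Let nu := growth_weight R m.

Lemma shift_scale_ge1 : 1 <= L.
Proof. by rewrite mulr_ege1 // exprn_ege1 // ler1n. Qed.

Let w_gt0 : forall n, 0 < w n := poly_weight_gt0 m shift_scale_ge1.

Let C_gt0 : 0 < C. Proof. exact: lt_le_trans ltr01 _. Qed.

Let nu_ge0 n : 0 <= nu n. Proof. exact: exprn_ge0. Qed.

Let k_gt0 n : 0 < k n. Proof. by rewrite invr_gt0. Qed.

Let k_sum N : \sum_(i < N) `|k i.+1| * nu i.+1 <= (4 * C)^-1.
Proof.
have -> : (4 * C)^-1 = 2 ^+ m.+1 / L.
  rewrite /L (exprD _ m) (exprS _ m); have : 0 < 2 ^+ m :> R by exact: exprn_gt0.
  by move: (2 ^+ m) => t t0; field; rewrite !gt_eqF.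
exact: (sum_growth_poly_weight m shift_scale_ge1).
Qed.

Let g_sum N : \sum_(n < N) `|g n.+1| * nu n.+1 <= (2 * C)^-1.
Proof.
have -> : (2 * C)^-1 = 2 * (4 * C)^-1 by field; rewrite gt_eqF.
apply: inv_coef_bound => //.
- by rewrite /nu /growth_weight expr1n.
- by move=> i j; exact: growth_weightM.
- by rewrite lef_pV2 ?posrE ?mulr_gt0 //; have := C_ge1; lra.
Qed.

Let sg1 : abs_summable (fun n => g n.+1 * nu n.+1).
Proof.
apply: (@abs_summable_bounded _ _ (2 * C)^-1) => N.
by under eq_bigr do rewrite normrM [`|nu _|]ger0_norm //; exact: g_sum.
Qed.

Let sg : abs_summable (fun n => g n * nu n).
Proof.
apply/cvg_ex; eexists; apply: cvg_seriesS; exact: sg1.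
Qed.

Let sk : abs_summable (fun n => k n * nu n).
Proof.
apply/cvg_ex; eexists; apply: cvg_seriesS.
apply: (@abs_summable_bounded _ (fun n => k n.+1 * nu n.+1) (4 * C)^-1) => N.
by under eq_bigr do rewrite normrM [`|nu _|]ger0_norm //; exact: k_sum.
Qed.

Lemma iter_form_bound n x y :
  `|r (iter n A x) (iter n A y)| <= C * ((r x x + r y y) / 2) * nu n.
Proof.
apply: le_trans (hrp_norm_le hr _ _) _.
have := A_growth n x; have := A_growth n y; rewrite -/(nu n); lra.
Qed.

Let sb x y : abs_summable (fun n => g n * r (iter n A x) (iter n A y)).
Proof.
apply: (@abs_summable_le _ _ (fun n => C * ((r x x + r y y) / 2) * `|g n * nu n|)).
  move=> n; rewrite !normrM (ger0_norm (nu_ge0 n)) mulrCA ler_wpM2l //.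
  exact: iter_form_bound.
exact: cvg_seriesM sg.
Qed.

(* The isometry identity sum_n k_n <A^n x, A^n y>_renormed = <x, y> forces the
   coefficients g of the reciprocal of the power series of k. *)
Definition renormed x y := rsum (fun n => g n * r (iter n A x) (iter n A y)).

Let renormed_close x : `|renormed x x - r x x| <= 2^-1 * r x x.
Proof.
have sb1 : abs_summable (fun n => g n.+1 * r (iter n.+1 A x) (iter n.+1 A x)).
  exact: (abs_summableS (@sb x x)).
rewrite /renormed rsumS // /g inv_coef0 mul1r addrC addKr -/g.
apply: le_trans (normr_rsum sb1) _; apply: rsum_le => // N.
apply: (@le_trans _ _ (\sum_(n < N) C * r x x * (`|g n.+1| * nu n.+1))).
  apply: ler_sum => n _; rewrite normrM mulrCA ler_wpM2l //.
  apply: le_trans (iter_form_bound _ _ _) _.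
  by rewrite (_ : (r x x + r x x) / 2 = r x x) //; field.
rewrite -mulr_sumr; apply: le_trans (ler_wpM2l _ (g_sum N)) _.
  by rewrite mulr_ge0 ?hrp_ge0 // ltW.
rewrite le_eqVlt; apply/orP; left; apply/eqP; field; by rewrite gt_eqF.
Qed.

Lemma renormed_ge x : 2^-1 * r x x <= renormed x x.
Proof. by have := renormed_close x; rewrite ler_norml => /andP[]; lra. Qed.

Lemma renormed_le x : renormed x x <= 3 / 2 * r x x.
Proof. by have := renormed_close x; rewrite ler_norml => /andP[]; lra. Qed.

Lemma renormed_hermitian : hermitian_real_part renormed.
Proof.
have lAn n := iter_linear_map n lA.
split=> [x y z|a x z|x y|x y|x|x x0].
- rewrite /renormed -rsumD; [|exact: sb..]; congr rsum; apply/funext => n.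
  by rewrite (linear_mapD (lAn n)) (hrpD hr) mulrDr.
- rewrite /renormed -rsumZ; last (exact: sb); congr rsum; apply/funext => n.
  by rewrite (linear_mapZ (lAn n)) (hrpZ hr) mulrCA.
- by congr rsum; apply/funext => n; rewrite (hrpC hr).
- by congr rsum; apply/funext => n; rewrite !(linear_mapZ (lAn n)) hrpi.
- by apply: le_trans (renormed_ge x); rewrite mulr_ge0 ?invr_ge0 ?hrp_ge0.
- apply: (hrp_eq0 hr); apply/eqP; rewrite eq_le hrp_ge0 // andbT.
  by have := renormed_ge x; rewrite x0; lra.
Qed.

Lemma renormed_complete : form_complete renormed.
Proof.
apply: (form_complete_equiv _ renormed_ge _ renormed_le cr); last by lra.
by rewrite invr_gt0.
Qed.

Local Notation K := (wl2 renormed_hermitian w_gt0).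

Let embed_term n x : w n * renormed ((k n)%:C *: iter n A x) ((k n)%:C *: iter n A x)
  = k n * renormed (iter n A x) (iter n A x).
Proof.
rewrite (hrpZ renormed_hermitian) (hrpZr renormed_hermitian) /k.
by field; rewrite gt_eqF.
Qed.

Lemma embed_wl2 x :
  (fun n => (k n)%:C *: iter n A x) \in wl2_pred renormed_hermitian w_gt0.
Proof.
apply: (@wl2_intro _ _ _ _ _ _ _ (fun n => 3 / 2 * C * r x x * `|k n * nu n|)).
  move=> n; have kn := k_gt0 n; rewrite embed_term.
  rewrite ger0_norm ?mulr_ge0 ?(ltW kn) // mulrCA ler_pM2l //.
  apply: le_trans (renormed_le _) _.
  have -> : 3 / 2 * C * r x x * nu n = 3 / 2 * (C * nu n * r x x) by ring.
  by rewrite ler_pM2l ?divr_gt0.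
exact: cvg_seriesM sk.
Qed.

Definition embed x : K := WL2 (embed_wl2 x).

Lemma embed_linear : is_linear_map embed.
Proof.
move=> a x y; apply: wl2_ext => n; rewrite wl2_valD wl2_valZ /=.
by rewrite (iter_linear_map n lA) scalerDr !scalerA mulrC.
Qed.

(** The weight [w n] cancels one of the two factors [k n]. As [A^n A^j = A^(n + j)], what remains is
    the double series of [rsum_convolution_inverse], whose value is the term of index 0. *)
Lemma embed_form x y : wl2_form (embed x) (embed y) = r x y.
Proof.
transitivity (rsum (fun n => k n * renormed (iter n A x) (iter n A y))).
  congr rsum; apply/funext => n /=.
  rewrite (hrpZ renormed_hermitian) (hrpZr renormed_hermitian) /k.
  by field; rewrite gt_eqF.
pose a n := r (iter n A x) (iter n A y).
transitivity (rsum (fun n => k n * rsum (fun j => g j * a (n + j)%N))).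
  congr rsum; apply/funext => n; congr (_ * rsum _); apply/funext => j.
  by rewrite /a addnC !iterD.
apply: (@rsum_convolution_inverse _ k g nu a (C * ((r x x + r y y) / 2))) => //.
- by move=> i j; exact: growth_weightM.
- by move=> p; apply: inv_coef_convolution; rewrite /k /w poly_weight0 invr1.
- by rewrite mulr_ge0 ?(ltW C_gt0) // divr_ge0 // addr_ge0 ?hrp_ge0.
- by move=> n; exact: iter_form_bound.
Qed.

(** Since [k n] is the inverse of [w n], the ratio in the backward shift turns [k n.+1] into [k n],
    and the index shift supplies the extra [A]. *)
Lemma wback_embed x : wback (poly_weight_le m shift_scale_ge1) (embed x) = embed (A x).
Proof.
apply: wl2_ext => n; rewrite /= /back_seq /= -iterS iterSr scalerA -rmorphM /=.
congr (_ %:C *: _); rewrite -[LHS]/(w n.+1 / w n * (w n.+1)^-1) mulrAC divff.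
  by rewrite mul1r.
by rewrite gt_eqF.
Qed.

End Lifting.

(** * From operator norms to quadratic growth bounds, and the conclusion *)

Lemma bounded_op_iter (R : realType) (V : lmodType R[i]) (ip : V -> V -> R[i])
    (T : V -> V) n : bounded_op ip T -> bounded_op ip (iter n T).
Proof.
move=> [lT [M TM]]; split; first exact: iter_linear_map.
have TM' x : hnorm ip (T x) <= `|M| * hnorm ip x.
  by apply: le_trans (TM x) _; rewrite ler_wpM2r ?sqrtr_ge0 // ler_norm.
exists (`|M| ^+ n); elim: n => [|n IH] x; first by rewrite expr0 mul1r.
by rewrite exprS -mulrA /=; apply: le_trans (TM' _) _; rewrite ler_wpM2l.
Qed.

Lemma hnorm_le_opnorm (R : realType) (V : lmodType R[i]) (ip : V -> V -> R[i])
    (T : V -> V) x : is_inner_product ip -> bounded_op ip T ->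
  hnorm ip (T x) <= opnorm ip T * hnorm ip x.
Proof.
move=> hip [lT [M TM]]; have hr := form_of_ip_hermitian hip.
have hE y : hnorm ip y = Num.sqrt (form_of_ip ip y y) by [].
have hZ (a : R) y : 0 <= a -> hnorm ip (a%:C *: y) = a * hnorm ip y.
  move=> a0; rewrite !hE (hrpZ hr) (hrpZr hr) mulrA -expr2.
  by rewrite sqrtrM ?sqr_ge0 // sqrtr_sqr ger0_norm.
have [x0|x0] := eqVneq (hnorm ip x) 0.
  by have := TM x; rewrite x0 !mulr0.
have {}x0 : 0 < hnorm ip x by rewrite lt_def x0 sqrtr_ge0.
rewrite -ler_pdivrMr // mulrC -hZ ?invr_ge0 ?(ltW x0) // -(linear_mapZ lT).
apply: ub_le_sup; last first.
  by exists ((hnorm ip x)^-1%:C *: x) => //=; rewrite hZ ?invr_ge0 ?(ltW x0) // mulVf ?gt_eqF.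
(* The absolute value is taken because [M] may be negative when the space is trivial. *)
exists `|M| => _ [y /= y1 <-]; apply: le_trans (TM y) _.
apply: le_trans (ler_norm _) _; rewrite normrM ler_piMr //.
by rewrite ger0_norm ?sqrtr_ge0.
Qed.

Lemma iter_growth (R : realType) (m : nat) (V : lmodType R[i]) (ip : V -> V -> R[i])
    (T : V -> V) : is_inner_product ip -> bounded_op ip T ->
  (exists M : R, forall n : nat, (1 <= n)%N ->
    (Num.sqrt (n%:R ^+ m))^-1 * opnorm ip (iter n T) <= M) ->
  exists2 C : R, 1 <= C & forall n x,
    form_of_ip ip (iter n T x) (iter n T x)
      <= C * growth_weight R m n * form_of_ip ip x x.
Proof.
move=> hip bT [M TM]; have hr := form_of_ip_hermitian hip.
have hE y : hnorm ip y ^+ 2 = form_of_ip ip y y by rewrite sqr_sqrtr //; exact: (hrp_ge0 hr y).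
(* The 1 covers [n = 0], where the growth hypothesis says nothing, and ensures [1 <= C]. *)
exists (1 + M ^+ 2) => [|n x]; first by rewrite lerDl sqr_ge0.
have r0 := hrp_ge0 hr x.
case: n => [|n].
  by rewrite /growth_weight expr1n mulr1 ler_peMl // lerDl sqr_ge0.
have n0 : 0 < n.+1%:R ^+ m :> R by rewrite exprn_gt0.
have s0 : 0 < Num.sqrt (n.+1%:R ^+ m) :> R by rewrite sqrtr_gt0.
have := TM n.+1 isT; rewrite mulrC ler_pdivrMr // => opM.
have h : hnorm ip (iter n.+1 T x) <= M * Num.sqrt (n.+1%:R ^+ m) * hnorm ip x.
  apply: le_trans (hnorm_le_opnorm _ hip (bounded_op_iter n.+1 bT)) _.
  by rewrite ler_wpM2r ?sqrtr_ge0.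
have : hnorm ip (iter n.+1 T x) ^+ 2 <= (M * Num.sqrt (n.+1%:R ^+ m) * hnorm ip x) ^+ 2.
  by rewrite ler_sqr ?nnegrE ?sqrtr_ge0 //; exact: le_trans (sqrtr_ge0 _) h.
rewrite !exprMn !hE sqr_sqrtr ?(ltW n0) // => /le_trans; apply.
rewrite ler_wpM2r // ler_pM ?sqr_ge0 ?(ltW n0) ?lerDr //.
by rewrite lerXn2r ?nnegrE // ler_nat.
Qed.

Theorem theorem2p1 (R : realType) (m : nat)
  (H : lmodType R[i]) (ipH : H -> H -> R[i]) (hH : is_hilbert ipH)
  (T : H -> H) (hT : bounded_op ipH T)
  (hgrowth : exists M : R, forall n : nat, (1 <= n)%N ->
      (Num.sqrt (n%:R ^+ m))^-1 * opnorm ipH (iter n T) <= M) :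
  exists (K : lmodType R[i]) (ipK : K -> K -> R[i]) (J : H -> K) (S : K -> K),
    [/\ is_hilbert ipK, isometric_embedding ipH ipK J, bounded_op ipK S
       & is_lifting ipH ipK J T S] /\
    [/\ m_isometric ipK (m + 3) S, expansive ipK S & analytic S].
Proof.
case: hH => hip cip; have lT : is_linear_map T by case: hT.
pose r := form_of_ip ipH.
have hr : hermitian_real_part r by exact: form_of_ip_hermitian.
have cr : form_complete r by exact: form_of_ip_complete.
have [C C1 TC] := iter_growth hip hT hgrowth.
have CnuC n : 0 <= C * growth_weight R m n.
  by rewrite mulr_ge0 ?exprn_ge0 // (le_trans ler01).
(* The growth estimate at [n = 1] is the boundedness needed for the adjoint. *)
have [Ta TTa] : exists Ta, forall x y, r (T x) y = r x (Ta y).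
  exact: (adjoint_exists hr cr lT (CnuC 1%N) (TC 1%N)).
have lTa := adjoint_linear hr lT TTa.
have TaC n x : r (iter n Ta x) (iter n Ta x) <= C * growth_weight R m n * r x x.
  exact: (iter_adjoint_bound hr TTa (TC n)).
pose L1 := shift_scale_ge1 m C1.
(* The construction is applied to [Ta], whose powers obey the same growth bound; the backward shift
   extends [Ta], so its adjoint, the forward shift, lifts [T]. *)
pose hb := renormed_hermitian hr lTa C1 TaC.
pose hK := wl2_form_hermitian hb (poly_weight_gt0 m L1).
pose J := embed hr lTa C1 TaC.
pose w_le := poly_weight_le m L1.
exists (wl2 hb (poly_weight_gt0 m L1)), (ip_of_form (@wl2_form _ _ _ hb _ _)), J,
  (wshift w_le).
have w_nd := poly_weight_nd m L1.
split; split.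
- apply: ip_of_form_hilbert => //; apply: wl2_form_complete.
  exact: renormed_complete.
- split=> [|x y]; first exact: embed_linear.
  (* Moving ['i] inside the embedding lets [embed_form] treat the real and the imaginary part
     alike. *)
  rewrite /ip_of_form -(linear_mapZ (embed_linear _ _ _ _)) !embed_form.
  exact: form_of_ipK.
- exact: wshift_bounded.
- exists Ta, (wback w_le); split; last exact: wback_embed.
    move=> x y; rewrite -!(form_of_ipK hip).
    exact: is_adjoint_ip_of_form hr lT TTa x y.
  exact: wshift_adjoint.
- apply: wshift_m_isometric; exact: poly_weight_difference.
- exact: wshift_expansive.
- exact: wshift_analytic.
Qed.
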